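(* Let $S$ be a Hilbert-style proof system for the implicational propositional language whose only inference rule is modus ponens and whose axioms include all instances of the schemes $A \supset (B \supset A)$ and $[A \supset (B \supset C)] \supset [(A \supset B) \supset (A \supset C)]$ (and possibly instances of further axiom schemes). Let $\mathbb{L}$ be the set of equivalence classes of well-formed formulas under $A \equiv B$ iff ($A \vdash_S B$ and $B \vdash_S A$), partially ordered by $[A] \leqslant [B]$ iff $A \vdash_S B$. Then every instance of the Peirce scheme $[(A \supset B) \supset A] \supset A$ is a theorem of $S$ if and only if for all well-formed formulas $A, B$, the class $[(A \supset B) \supset B]$ is the supremum (least upper bound) of $\{[A], [B]\}$ in $(\mathbb{L}, \leqslant)$.
   Context: The implicational propositional language has propositional variables and the single binary connective $\supset$; well-formed formulas are built from variables using $\supset$. $\Gamma \vdash_S C$ means $C$ is deducible in $S$ from the hypotheses $\Gamma$ using the axioms of $S$ and modus ponens (from $A$ and $A \supset B$ infer $B$); a theorem of $S$ is a formula deducible from no hypotheses. $[A]$ denotes the $\equiv$-class of $A$; the relation $\equiv$ is an equivalence relation and $\leqslant$ is a well-defined partial order on $\mathbb{L}$. The paper writes $A \vee B$ for $(A \supset B) \supset B$. *)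

(* Defs.v *)
From HB Require Import structures.
From mathcomp Require Import all_boot all_order.
From mathcomp Require Import boolp classical_sets.

Set Implicit Arguments.
Unset Strict Implicit.
Unset Printing Implicit Defensive.

Import Order.TTheory.
Local Open Scope classical_set_scope.
Local Open Scope quotient_scope.

Inductive formula (V : Type) : Type :=
| Var of V
| Imp of formula V & formula V.

Declare Scope formula_scope.
Delimit Scope formula_scope with fm.
Bind Scope formula_scope with formula.
Notation "A ⊃ B" := (Imp A B) (at level 60, right associativity) : formula_scope.
Local Open Scope formula_scope.

HB.instance Definition _ (V : Type) := gen_eqMixin (formula V).
HB.instance Definition _ (V : Type) := gen_choiceMixin (formula V).

(* A Hilbert system with modus ponens as its only rule is given by its set Ax
   of axioms. *)
Inductive deducible (V : Type) (Ax Gamma : set (formula V)) :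
  formula V -> Prop :=
| ded_ax A : Ax A -> deducible Ax Gamma A
| ded_hyp A : Gamma A -> deducible Ax Gamma A
| ded_mp A B : deducible Ax Gamma A -> deducible Ax Gamma (A ⊃ B) ->
    deducible Ax Gamma B.

Definition is_theorem (V : Type) (Ax : set (formula V)) (A : formula V) :=
  deducible Ax set0 A.

Section Lindenbaum.
Variables (V : Type) (Ax : set (formula V)).
Implicit Types A B C : formula V.

Definition entails A B := deducible Ax [set A] B.

Lemma entails_refl A : entails A A.
Proof. exact: ded_hyp. Qed.

Lemma entails_trans B A C : entails A B -> entails B C -> entails A C.
Proof.
move=> AB; elim=> [D axD|D ->//|D E _ AD _ ADE]; first exact: ded_ax.
exact: ded_mp AD ADE.
Qed.

Definition equivf : rel (formula V) :=
  fun A B => `[< entails A B /\ entails B A >].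

Lemma equivf_refl : reflexive equivf.
Proof. by move=> A; apply/asboolP; split; exact: entails_refl. Qed.

Lemma equivf_sym : symmetric equivf.
Proof. by move=> A B; apply/asboolP/asboolP => -[]. Qed.

Lemma equivf_trans : transitive equivf.
Proof.
move=> B A C /asboolP[AB BA] /asboolP[BC CB]; apply/asboolP.
by split; [exact: entails_trans BC | exact: entails_trans BA].
Qed.

Definition equivf_equiv : equiv_rel (formula V) :=
  EquivRel equivf equivf_refl equivf_sym equivf_trans.

Definition lindenbaum : Type := {eq_quot equivf_equiv}.
HB.instance Definition _ := Choice.on lindenbaum.
HB.instance Definition _ := EqQuotient.on lindenbaum.

Definition class A : lindenbaum := \pi_lindenbaum A.

Lemma eq_class A B : class A = class B <-> entails A B /\ entails B A.
Proof.
have eqP : reflect (class A = class B) (equivf_equiv A B) by exact: eqmodP.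
by split=> [/eqP/asboolP|AB] //; apply/eqP/asboolP.
Qed.

(* The order is read off on canonical representatives; le_class below shows
   that it does not depend on their choice. *)
Definition le_lind (x y : lindenbaum) : bool := `[< entails (repr x) (repr y) >].

Lemma le_lindE A B : le_lind (class A) (class B) <-> entails A B.
Proof.
have /eq_class[A1 A2] : class (repr (class A)) = class A by exact: reprK.
have /eq_class[B1 B2] : class (repr (class B)) = class B by exact: reprK.
split=> [/asboolP AB | AB]; last apply/asboolP.
  exact: entails_trans A2 (entails_trans AB B1).
exact: entails_trans A1 (entails_trans AB B2).
Qed.

Lemma le_lind_refl : reflexive le_lind.
Proof. by move=> x; apply/asboolP; exact: entails_refl. Qed.

Lemma le_lind_anti : antisymmetric le_lind.
Proof.
move=> x y /andP[/asboolP xy /asboolP yx].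
by rewrite -[x]reprK -[y]reprK; apply/eq_class.
Qed.

Lemma le_lind_trans : transitive le_lind.
Proof.
by move=> y x z /asboolP xy /asboolP yz; apply/asboolP; exact: entails_trans yz.
Qed.

Fact lindenbaum_display : Order.disp_t. Proof. exact: Order.Disp tt tt. Qed.

HB.instance Definition _ := Order.Le_isPOrder.Build lindenbaum_display lindenbaum
  le_lind_refl le_lind_anti le_lind_trans.

Lemma le_class A B : (class A <= class B)%O <-> entails A B.
Proof. exact: le_lindE. Qed.

End Lindenbaum.

(* Main.v *)
(* In one direction, Peirce's law for C and B turns (C ⊃ B) ⊃ C into C: if
   A ⊢ C and B ⊢ C, then (A ⊃ B) ⊃ B and C ⊃ B yield A ⊃ B, hence B, hence C.
   Conversely, the supremum of A and A ⊃ B is the class of the contraction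
   theorem (A ⊃ (A ⊃ B)) ⊃ (A ⊃ B), while the Peirce formula is deducible from
   both A and A ⊃ B; lying above their supremum, it is a theorem. *)
Require Import Defs.
From mathcomp Require Import all_boot all_order.
From mathcomp Require Import boolp classical_sets.

Local Open Scope classical_set_scope.
Local Open Scope formula_scope.

Lemma deducible_sub (V : Type) (Ax Gamma Delta : set (formula V))
    (A : formula V) :
  Gamma `<=` Delta -> deducible Ax Gamma A -> deducible Ax Delta A.
Proof.
move=> GD; elim=> [B axB|B /GD GB|B C _ DB _ DBC].
- exact: ded_ax.
- exact: ded_hyp.
- exact: ded_mp DB DBC.
Qed.

(** From left to right, by induction on the derivation: [AxK] handles axioms and members of [Gamma],
    [AxS] handles modus ponens, which is the only rule. *)
Lemma deduction (V : Type) (Ax : set (formula V))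
    (AxK : forall A B : formula V, Ax (A ⊃ (B ⊃ A)))
    (AxS : forall A B C : formula V,
      Ax ((A ⊃ (B ⊃ C)) ⊃ ((A ⊃ B) ⊃ (A ⊃ C))))
    (Gamma : set (formula V)) (A B : formula V) :
  deducible Ax (A |` Gamma) B <-> deducible Ax Gamma (A ⊃ B).
Proof.
have weaken C : deducible Ax Gamma C -> deducible Ax Gamma (A ⊃ C).
  by move=> GC; apply: ded_mp GC _; apply: ded_ax.
split; last first.
  move=> GAB; apply: (@ded_mp _ _ _ A); first by apply: ded_hyp; left.
  by apply: deducible_sub GAB => D GD; right.
elim=> [C axC|C [->|GC]|C D _ GAC _ GACD].
- by apply: weaken; apply: ded_ax.
(* The discharged hypothesis itself: [A ⊃ A] is the combinator S K K. *)
- apply: (@ded_mp _ _ _ (A ⊃ (A ⊃ A))); first exact: ded_ax.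
  apply: (@ded_mp _ _ _ (A ⊃ ((A ⊃ A) ⊃ A))); exact: ded_ax.
- by apply: weaken; apply: ded_hyp.
- apply: ded_mp GAC _; apply: ded_mp GACD _; exact: ded_ax.
Qed.

(** An implication proved outright can be reused under any further hypotheses, whereas [entails]
    fixes a single one. *)
Lemma entails_theorem (V : Type) (Ax : set (formula V))
    (AxK : forall A B : formula V, Ax (A ⊃ (B ⊃ A)))
    (AxS : forall A B C : formula V,
      Ax ((A ⊃ (B ⊃ C)) ⊃ ((A ⊃ B) ⊃ (A ⊃ C))))
    (A B : formula V) :
  entails Ax A B <-> is_theorem Ax (A ⊃ B).
Proof. by rewrite /is_theorem -(deduction _ _ AxK AxS) setU0. Qed.

Lemma supremums_class (V : Type) (Ax : set (formula V)) (A B S : formula V) :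
  supremums [set class Ax A; class Ax B] (class Ax S) <->
  [/\ entails Ax A S, entails Ax B S &
      forall C, entails Ax A C -> entails Ax B C -> entails Ax S C].
Proof.
split=> [[ubS lubS]|[AS BS lubS]].
  split=> [||C AC BC].
  - by apply/le_class/ubS; left.
  - by apply/le_class/ubS; right.
  - by apply/le_class/lubS => _ [->|->]; apply/le_class.
split=> [_ [->|->]|x ubx]; [exact/le_class|exact/le_class|].
(* An arbitrary upper bound is the class of its representative, so formulas suffice as test
   objects. *)
have xE : class Ax (repr x) = x by exact: reprK.
rewrite -xE; apply/le_class/lubS; apply/le_class; rewrite xE; apply: ubx.
  by left.
by right.
Qed.

Theorem theorem5 (V : Type) (Ax : set (formula V))
    (AxK : forall A B : formula V, Ax (A ⊃ (B ⊃ A)))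
    (AxS : forall A B C : formula V,
      Ax ((A ⊃ (B ⊃ C)) ⊃ ((A ⊃ B) ⊃ (A ⊃ C)))) :
  (forall A B : formula V, is_theorem Ax (((A ⊃ B) ⊃ A) ⊃ A)) <->
  (forall A B : formula V,
     supremums [set class Ax A; class Ax B] (class Ax ((A ⊃ B) ⊃ B))).
Proof.
have ded Gamma A B := (deduction _ _ AxK AxS Gamma A B).1.
have thm := entails_theorem _ _ AxK AxS.
have lift Gamma A : is_theorem Ax A -> deducible Ax Gamma A.
  by apply: deducible_sub => D [].
split=> [peirce A B|sup A B].
  apply/supremums_class; split=> [||C /thm AC /thm BC].
  - apply/ded; apply: (@ded_mp _ _ _ A); apply: ded_hyp; first by right.
    by left.
  - by apply/ded; apply: ded_hyp; right.
  apply: ded_mp _ (lift _ _ (peirce C B)); apply/ded.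
  (* The goal is now [C], from the hypotheses [C ⊃ B] and [(A ⊃ B) ⊃ B]. *)
  apply: ded_mp _ (lift _ _ BC).
  apply: (@ded_mp _ _ _ (A ⊃ B)); last by apply: ded_hyp; right.
  apply/ded; apply: (@ded_mp _ _ _ C).
    by apply: ded_mp _ (lift _ _ AC); apply: ded_hyp; left.
  by apply: ded_hyp; right; left.
have /supremums_class[_ _ lub] := sup A (A ⊃ B).
apply: (@ded_mp _ _ _ ((A ⊃ (A ⊃ B)) ⊃ (A ⊃ B))).
  do 2!apply/ded; apply: (@ded_mp _ _ _ A); first by apply: ded_hyp; left.
  apply: (@ded_mp _ _ _ A); first by apply: ded_hyp; left.
  by apply: ded_hyp; right; left.
(* The upper bound tested is the Peirce formula. Above [A] it lies by weakening; above [A ⊃ B],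
   because its premise [(A ⊃ B) ⊃ A] then yields [A]. *)
apply/thm/lub.
  by apply/ded; apply: ded_hyp; right.
apply/ded; apply: (@ded_mp _ _ _ (A ⊃ B)); apply: ded_hyp; first by right.
by left.
Qed.
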